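(* There exists a countable two-dimensional sofic shift $X$ and a sequence $(x_i)_{i \geq 1}$ of points of $X$ with $x_i \succ x_{i+1}$ for all $i \geq 1$ (an infinite strictly descending chain in the subpattern order).
   Context: A two-dimensional sofic shift is the image of a two-dimensional subshift of finite type (configurations in $S^{\mathbb{Z}^2}$ avoiding a finite set of forbidden finite patterns) under a block map (a continuous map commuting with the shifts). For configurations $x,y$, $x \succcurlyeq y$ means every finite pattern occurring in $y$ also occurs in $x$; $x \succ y$ means $x \succcurlyeq y$ but not $y \succcurlyeq x$. *)

(* Defs.v *)
From mathcomp Require Import all_boot.
From Stdlib Require Import ZArith List.

Definition config (A : Type) := (Z * Z)%type -> A.

Definition vadd (p v : Z * Z) : Z * Z := ((fst p + fst v)%Z, (snd p + snd v)%Z).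

Definition pattern (A : Type) := list ((Z * Z) * A).

Definition occurs {A : Type} (P : pattern A) (x : config A) : Prop :=
  exists v : Z * Z, forall pa, List.In pa P -> x (vadd (fst pa) v) = snd pa.

Definition sub_ge {A : Type} (x y : config A) : Prop :=
  forall P : pattern A, occurs P y -> occurs P x.

Definition sub_gt {A : Type} (x y : config A) : Prop :=
  sub_ge x y /\ ~ sub_ge y x.

Definition SFT {S : Type} (F : list (pattern S)) (x : config S) : Prop :=
  forall P, List.In P F -> ~ occurs P x.

Definition shift {A : Type} (v : Z * Z) (x : config A) : config A :=
  fun p => x (vadd p v).

Definition agree_on {A : Type} (W : list (Z * Z)) (x y : config A) : Prop :=
  forall p, List.In p W -> x p = y p.

(* Block map on Y: continuous (product topology, restricted to Y) and
   commuting with the shifts (on Y, which is shift-invariant). *)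
Definition block_map {S A : Type} (Y : config S -> Prop)
    (f : config S -> config A) : Prop :=
  (forall x, Y x -> forall W : list (Z * Z), exists N : list (Z * Z),
      forall y, Y y -> agree_on N x y -> agree_on W (f x) (f y)) /\
  (forall x v, Y x -> f (shift v x) = shift v (f x)).

Definition sofic {A : finType} (X : config A -> Prop) : Prop :=
  exists (S : finType) (F : list (pattern S)) (f : config S -> config A),
    block_map (SFT F) f /\
    forall x, X x <-> exists y, SFT F y /\ f y = x.

Definition countable_set {A : Type} (X : config A -> Prop) : Prop :=
  exists g : config A -> nat, forall x y, X x -> X y -> g x = g y -> x = y.

(* Main.v *)
(* Above a row carrying a binary counter to the right of a boundary and a marker at
   distance s to its left, the counter is incremented as follows: a signal travels from the
   marker to the boundary; when it arrives, the carry runs through the v trailing ones, the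
   marker makes one step left, and then moves right for the v steps that the end of the carry
   takes to come back to the boundary. So s becomes s + 1 - v, the change of the number of
   ones. The sofic shift keeps only the segments between marker and boundary on the report
   rows, where such a cycle starts, and forgets the digits.

   Countability: two nonempty segments enclose a complete signal run, so marker and boundary
   exist; as the marker never crosses the boundary, the counter has at most s ones, hence is
   a natural number, which moreover bounds the number of earlier report rows. The first
   report row then determines the picture. All other pictures have a single segment.

   Chain: the i-th point starts with counter 0 and s = i, so that s = i + (number of ones)
   later on. At counter value 2^N it has s = i + 1, the low N digits are 0 and the previous
   report row is more than N rows below: it looks like the start of the (i+1)-st point. The
   latter has no segment of length i. *)
Require Import Defs.
From HB Require Import structures.
From Stdlib Require Import ZArith List Lia FunctionalExtensionality ClassicalEpsilon.
From mathcomp Require Import all_boot zify ssrZ.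

(** * The alphabet and the local rule *)

Inductive phase := Report | Wait | Carry | Return.

Definition phase_code (p : phase) : bool * bool :=
  match p with
  | Report => (true, true) | Wait => (true, false)
  | Carry => (false, true) | Return => (false, false)
  end.

Definition phase_decode (c : bool * bool) : phase :=
  match c with
  | (true, true) => Report | (true, false) => Wait
  | (false, true) => Carry | (false, false) => Return
  end.

Lemma phase_codeK : cancel phase_code phase_decode.
Proof. by case. Qed.

HB.instance Definition _ := Finite.copy phase (can_type phase_codeK).

(* Each boolean layer but [dg] is, along a row, the indicator of the cells at or to the right of
   one object: the fixed boundary [bd], the marker [mk], the signal [sg] sent from the
   marker to the boundary, the end [cr] of the carry; [dg] holds the binary digits,
   which start at the boundary, least significant first. *)
Record cell := Cell
  { ph : phase; bd : bool; mk : bool; sg : bool; cr : bool; dg : bool }.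

Definition cell_code (c : cell) :=
  (ph c, bd c, mk c, sg c, cr c, dg c).

Definition cell_decode c : cell :=
  let: (p, b, m, s, r, d) := c in Cell p b m s r d.

Lemma cell_codeK : cancel cell_code cell_decode.
Proof. by case. Qed.

HB.instance Definition _ := Finite.copy cell (can_type cell_codeK).

(** The lengths of the phases are guessed and then checked: a wait that goes on once [sg] is on the
    boundary, or a return that goes on once [cr] is there, breaks every clause one row later. The
    place of [cr] on a [Carry] row is also guessed; the digit clause checks that it is the lowest
    zero. *)
Definition rule (l c r u : cell) : bool :=
  [&& ph l == ph c, bd l ==> bd c, mk l ==> mk c, bd c ==> mk c, bd u == bd c &
  match ph c with
  | Report => [&& ph u \in [:: Wait; Carry], cr c == bd c, sg c == mk c,
                  mk u == mk c, sg u == sg l & dg u == dg c]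
  | Wait => [&& ph u \in [:: Wait; Carry], bd c ==> sg c,
                mk u == mk c, sg u == sg l & dg u == dg c]
  | Carry => [&& ph u \in [:: Return; Report], sg c == bd c,
                 mk u == mk r, cr u == cr c &
                 if cr l then dg u == dg c
                 else if cr c then ~~ dg c && dg u
                 else bd c ==> dg c && ~~ dg u]
  | Return => [&& ph u \in [:: Return; Report], cr c ==> bd c,
                  mk u == mk l, cr u == cr r & dg u == dg c]
  end].

Definition valid (y : config cell) : Prop :=
  forall x t : Z, rule (y (x - 1, t)%Z) (y (x, t)) (y (x + 1, t)%Z) (y (x, t + 1)%Z).

Lemma SFT_of_rule (S : finType) (R : S -> S -> S -> S -> bool) :
  exists F : list (pattern S), forall y,
    SFT F y <->
    forall x t : Z, R (y (x - 1, t)%Z) (y (x, t)) (y (x + 1, t)%Z) (y (x, t + 1)%Z).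
Proof.
pose pat (q : S * S * S * S) : pattern S := let: (l, c, r, u) := q in
  [:: ((-1, 0)%Z, l); ((0, 0)%Z, c); ((1, 0)%Z, r); ((0, 1)%Z, u)].
pose bad := [pred q : S * S * S * S | let: (l, c, r, u) := q in ~~ R l c r u].
exists (List.map pat (List.filter bad (enum {: S * S * S * S}))) => y; split.
- move=> yF x t; apply/negPn/negP => nR.
  pose q := (y (x - 1, t)%Z, y (x, t), y (x + 1, t)%Z, y (x, t + 1)%Z).
  apply: (yF (pat q)).
  + apply: List.in_map; apply/filter_In; split=> //.
    have : q \in enum {: S * S * S * S} by rewrite mem_enum.
    elim: (enum _) => //= a s IHs; rewrite inE => /orP[/eqP->|/IHs]; [left|right] => //.
  + exists (x, t) => pa.
    by case=> [<-|[<-|[<-|[<-|[]]]]]; rewrite /vadd; cbn [fst snd]; congr (y (_, _)); lia.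
- move=> yR P /in_map_iff[[[[l c] r] u] [<- /filter_In[_ nR]]] [[x t] occ].
  move: nR => /negP; apply.
  have := yR x t; congr (is_true (R _ _ _ _)).
  + by rewrite -[RHS](occ _ (or_introl _ erefl)) /vadd; cbn [fst snd]; congr (y (_, _)); lia.
  + by rewrite -[RHS](occ _ (or_intror _ (or_introl _ erefl))) /vadd; cbn [fst snd];
      congr (y (_, _)); lia.
  + by rewrite -[RHS](occ _ (or_intror _ (or_intror _ (or_introl _ erefl)))) /vadd; cbn [fst snd];
      congr (y (_, _)); lia.
  + by rewrite -[RHS](occ _ (or_intror _ (or_intror _ (or_intror _ (or_introl _ erefl))))) /vadd;
      cbn [fst snd]; congr (y (_, _)); lia.
Qed.

(** * Monotone boolean functions on the integers *)

Lemma Z_const (T : Type) (g : Z -> T) :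
  (forall x, g (x - 1)%Z = g x) -> forall x x', g x = g x'.
Proof.
move=> gE; suff g0 x : g x = g 0%Z by move=> x x'; rewrite !g0.
apply: (Z.bi_induction (fun x => g x = g 0%Z)) => [|z] //.
by rewrite -(gE (Z.succ z)) (_ : (Z.succ z - 1 = z)%Z); last lia.
Qed.

Definition Zmono (g : Z -> bool) := forall x x', (x <= x')%Z -> g x -> g x'.

Lemma Zmono_step (g : Z -> bool) : (forall x, g (x - 1)%Z ==> g x) -> Zmono g.
Proof.
move=> gS x x' le_xx' gx; rewrite (_ : x' = x + Z.of_nat (Z.to_nat (x' - x)))%Z; last lia.
elim: (Z.to_nat _) => [|n IHn]; first by rewrite (_ : (x + _ = x)%Z) //; lia.
apply: (implyP (gS _)); rewrite (_ : (_ - 1 = x + Z.of_nat n)%Z) //; lia.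
Qed.

(* The steps of [inl] are constant: jumps at infinity. *)
Definition step (e : bool + Z) (x : Z) : bool :=
  match e with inl c => c | inr p => (p <=? x)%Z end.

Lemma Zmono_jump (g : Z -> bool) (a c : Z) :
  Zmono g -> g a = false -> g c -> exists p, forall x, g x = (p <=? x)%Z.
Proof.
move=> gm ga; have [n] := ubnP (Z.to_nat (c - a)); elim: n c => // n IHn c le_n gc.
have lt_ac : (a < c)%Z.
  by case: (Z.lt_ge_cases a c) => // /gm/(_ gc); rewrite ga.
case E : (g (c - 1)%Z); first by apply: (IHn _ _ E); lia.
exists c => x; case: Z.leb_spec => [/gm->//|lt_xc].
by apply/negbTE/negP => gx; move: E; rewrite (gm x) //; lia.
Qed.

Lemma Zmono_is_step (g : Z -> bool) : Zmono g -> exists e, g =1 step e.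
Proof.
move=> gm; case: (classic (exists c, g c)) => [[c gc]|ng]; last first.
  by exists (inl false) => x; apply/negP => gx; apply: ng; exists x.
case: (classic (exists a, g a = false)) => [[a ga]|ng]; last first.
  by exists (inl true) => x /=; case E : (g x) => //; case: ng; exists x.
by have [p gE] := Zmono_jump g a c gm ga gc; exists (inr p).
Qed.

(** * The rule read row by row *)

Definition rowph (y : config cell) (t : Z) : phase := ph (y (0%Z, t)).

Lemma validE y : valid y -> forall x t,
  [/\ ph (y (x - 1, t)%Z) = ph (y (x, t)),
      bd (y (x - 1, t)%Z) ==> bd (y (x, t)),
      mk (y (x - 1, t)%Z) ==> mk (y (x, t)),
      bd (y (x, t)) ==> mk (y (x, t)) &
      bd (y (x, t + 1)%Z) = bd (y (x, t))].
Proof. by move=> yv x t; case/and5P: (yv x t) => /eqP ? ? ? ? /andP[/eqP]. Qed.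

Lemma ph_row y : valid y -> forall x t, ph (y (x, t)) = rowph y t.
Proof.
move=> yv x t; apply: (Z_const _ (fun x => ph (y (x, t)))) => {}x.
by case: (validE y yv x t).
Qed.

Lemma bd_column y : valid y -> forall x t t', bd (y (x, t)) = bd (y (x, t')).
Proof.
move=> yv x; apply: (Z_const _ (fun t => bd (y (x, t)))) => t.
case: (validE y yv x (t - 1)%Z) => _ _ _ _ <-; congr (bd (y (_, _))); lia.
Qed.

Lemma bd_mono y : valid y -> forall t, Zmono (fun x => bd (y (x, t))).
Proof. by move=> yv t; apply: Zmono_step => x; case: (validE y yv x t). Qed.

Lemma mk_mono y : valid y -> forall t, Zmono (fun x => mk (y (x, t))).
Proof. by move=> yv t; apply: Zmono_step => x; case: (validE y yv x t). Qed.

Lemma bd_mk y : valid y -> forall x t, bd (y (x, t)) -> mk (y (x, t)).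
Proof. by move=> yv x t; apply/implyP; case: (validE y yv x t). Qed.

Lemma report_row y t : valid y -> rowph y t = Report ->
  (rowph y (t + 1)%Z = Wait \/ rowph y (t + 1)%Z = Carry) /\ forall x,
  [/\ cr (y (x, t)) = bd (y (x, t)), sg (y (x, t)) = mk (y (x, t)),
      mk (y (x, t + 1)%Z) = mk (y (x, t)), sg (y (x, t + 1)%Z) = sg (y (x - 1, t)%Z)
    & dg (y (x, t + 1)%Z) = dg (y (x, t))].
Proof.
move=> yv tR; split=> [|x].
  case/and5P: (yv 0%Z t) => _ _ _ _ /andP[_].
  rewrite [ph (y (_, t))]tR => /and5P[+ _ _ _ _].
  by rewrite !inE -/(rowph y (t + 1)%Z) => /orP[/eqP|/eqP]; auto.
case/and5P: (yv x t) => _ _ _ _ /andP[_].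
by rewrite (ph_row y yv) tR => /and5P[_ /eqP ? /eqP ? /eqP ? /andP[/eqP ? /eqP]].
Qed.

Lemma wait_row y t : valid y -> rowph y t = Wait ->
  (rowph y (t + 1)%Z = Wait \/ rowph y (t + 1)%Z = Carry) /\ forall x,
  [/\ bd (y (x, t)) -> sg (y (x, t)),
      mk (y (x, t + 1)%Z) = mk (y (x, t)), sg (y (x, t + 1)%Z) = sg (y (x - 1, t)%Z)
    & dg (y (x, t + 1)%Z) = dg (y (x, t))].
Proof.
move=> yv tR; split=> [|x].
  case/and5P: (yv 0%Z t) => _ _ _ _ /andP[_].
  rewrite [ph (y (_, t))]tR => /and5P[+ _ _ _ _].
  by rewrite !inE -/(rowph y (t + 1)%Z) => /orP[/eqP|/eqP]; auto.
case/and5P: (yv x t) => _ _ _ _ /andP[_].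
by rewrite (ph_row y yv) tR => /and5P[_ /implyP ? /eqP ? /eqP ? /eqP].
Qed.

Lemma carry_row y t : valid y -> rowph y t = Carry ->
  (rowph y (t + 1)%Z = Return \/ rowph y (t + 1)%Z = Report) /\ forall x,
  [/\ sg (y (x, t)) = bd (y (x, t)),
      mk (y (x, t + 1)%Z) = mk (y (x + 1, t)%Z), cr (y (x, t + 1)%Z) = cr (y (x, t)) &
      if cr (y (x - 1, t)%Z) then dg (y (x, t + 1)%Z) == dg (y (x, t))
      else if cr (y (x, t)) then ~~ dg (y (x, t)) && dg (y (x, t + 1)%Z)
      else bd (y (x, t)) ==> dg (y (x, t)) && ~~ dg (y (x, t + 1)%Z)].
Proof.
move=> yv tR; split=> [|x].
  case/and5P: (yv 0%Z t) => _ _ _ _ /andP[_].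
  rewrite [ph (y (_, t))]tR => /and5P[+ _ _ _ _].
  by rewrite !inE -/(rowph y (t + 1)%Z) => /orP[/eqP|/eqP]; auto.
case/and5P: (yv x t) => _ _ _ _ /andP[_].
by rewrite (ph_row y yv) tR => /and5P[_ /eqP ? /eqP ? /eqP ?].
Qed.

Lemma return_row y t : valid y -> rowph y t = Return ->
  (rowph y (t + 1)%Z = Return \/ rowph y (t + 1)%Z = Report) /\ forall x,
  [/\ cr (y (x, t)) -> bd (y (x, t)),
      mk (y (x, t + 1)%Z) = mk (y (x - 1, t)%Z), cr (y (x, t + 1)%Z) = cr (y (x + 1, t)%Z)
    & dg (y (x, t + 1)%Z) = dg (y (x, t))].
Proof.
move=> yv tR; split=> [|x].
  case/and5P: (yv 0%Z t) => _ _ _ _ /andP[_].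
  rewrite [ph (y (_, t))]tR => /and5P[+ _ _ _ _].
  by rewrite !inE -/(rowph y (t + 1)%Z) => /orP[/eqP|/eqP]; auto.
case/and5P: (yv x t) => _ _ _ _ /andP[_].
by rewrite (ph_row y yv) tR => /and5P[_ /implyP ? /eqP ? /eqP ? /eqP].
Qed.

(** Nothing forces a wait to end if there is no boundary, hence the cut-off [n]. The signal starts
    on the marker and gains one cell per row. *)
Lemma wait_run y t : valid y -> rowph y t = Report -> forall n : nat, 0 < n ->
  exists2 u : nat, 0 < u <= n &
  [/\ rowph y (t + Z.of_nat u)%Z = Carry \/
        (u = n /\ rowph y (t + Z.of_nat u)%Z = Wait),
      forall k : nat, 0 < k < u -> rowph y (t + Z.of_nat k)%Z = Wait &
      forall x, [/\ mk (y (x, t + Z.of_nat u)%Z) = mk (y (x, t)),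
                    sg (y (x, t + Z.of_nat u)%Z) = mk (y (x - Z.of_nat u, t)%Z) &
                    dg (y (x, t + Z.of_nat u)%Z) = dg (y (x, t))]].
Proof.
move=> yv tR; elim=> // -[_ _|n /(_ isT) [u /andP[u0 un] [uC uW uE]]].
  exists 1 => //; case: (report_row y t yv tR) => ph1 xE.
  split=> [|k|x]; [|lia|].
  + by case: ph1; [right|left].
  + by case: (xE x) => _ _ -> -> ->; split=> //; case: (xE (x - 1)%Z).
case: uC => [uC|[eun uWt]]; first by exists u; [lia|split=> //; left].
exists u.+1; first lia.
rewrite (_ : (t + Z.of_nat u.+1 = t + Z.of_nat u + 1)%Z); last lia.
have [ph1 xE] := wait_row y _ yv uWt.
split=> [|k ku|x].
+ by case: ph1; [right; split=> //; lia|left].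
+ by have [->//|ne] := eqVneq k u; apply: uW; lia.
+ case: (xE x) => _ -> -> ->; case: (uE x) => -> _ ->; split=> //.
  case: (uE (x - 1)%Z) => _ -> _; congr (mk (y (_, _))); lia.
Qed.

(** The [Carry] row moves the marker one cell left and keeps [cr] in place, whence the [+ 1]; every
    [Return] row then moves the marker right and [cr] left. *)
Lemma return_run y t : valid y -> rowph y t = Carry -> forall n : nat, 
  exists2 u : nat, u <= n &
  [/\ rowph y (t + 1 + Z.of_nat u)%Z = Report \/
        (u = n /\ rowph y (t + 1 + Z.of_nat u)%Z = Return),
      forall k : nat, k < u -> rowph y (t + 1 + Z.of_nat k)%Z = Return &
      forall x, [/\ mk (y (x, t + 1 + Z.of_nat u)%Z) = mk (y (x - Z.of_nat u + 1, t)%Z),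
                    cr (y (x, t + 1 + Z.of_nat u)%Z) = cr (y (x + Z.of_nat u, t)%Z) &
                    dg (y (x, t + 1 + Z.of_nat u)%Z) = dg (y (x, t + 1)%Z)]].
Proof.
move=> yv tR; elim=> [|n [u un [uC uW uE]]].
  exists 0 => //; case: (carry_row y t yv tR) => ph1 xE.
  rewrite (_ : (t + 1 + Z.of_nat 0 = t + 1)%Z); last lia.
  split=> [|k|x]; [|lia|].
  + by case: ph1; [right|left].
  + case: (xE x) => _ -> -> _; split=> //.
    * congr (mk (y (_, _))); lia.
    * congr (cr (y (_, _))); lia.
case: uC => [uC|[eun uWt]]; first by exists u; [lia|split=> //; left].
exists u.+1; first lia.
rewrite (_ : (t + 1 + Z.of_nat u.+1 = t + 1 + Z.of_nat u + 1)%Z); last lia.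
have [ph1 xE] := return_row y _ yv uWt.
split=> [|k ku|x].
+ by case: ph1; [right; split=> //; lia|left].
+ by have [->//|ne] := eqVneq k u; apply: uW; lia.
+ case: (xE x) => _ -> -> ->; case: (uE x) => _ _ ->; split=> //.
  * case: (uE (x - 1)%Z) => -> _ _; congr (mk (y (_, _))); lia.
  * case: (uE (x + 1)%Z) => _ -> _; congr (cr (y (_, _))); lia.
Qed.

(** * Binary increment on lists of digits *)

Notation digit l := (seq.nth false l).

Fixpoint inc (l : seq bool) : seq bool :=
  match l with
  | [::] => [:: true]
  | false :: l' => true :: l'
  | true :: l' => false :: inc l'
  end.

Fixpoint trailing_ones (l : seq bool) : nat :=
  if l is true :: l' then (trailing_ones l').+1 else 0.

Fixpoint val2 (l : seq bool) : nat :=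
  if l is b :: l' then b + (val2 l').*2 else 0.

Lemma digit_trailing_ones l : digit l (trailing_ones l) = false.
Proof. by elim: l => [|[] l IHl] //=. Qed.

Lemma digit_lt_trailing_ones l j : j < trailing_ones l -> digit l j.
Proof. by elim: l j => [|[] l IHl] //= [|j] //=; apply: IHl. Qed.

Lemma digit_inc l j : digit (inc l) j =
  if j < trailing_ones l then false else if j == trailing_ones l then true else digit l j.
Proof. by elim: l j => [|[] l IHl] [|j] //=; rewrite ?nth_nil ?IHl. Qed.

Lemma trailing_onesP (l : seq bool) (v : nat) :
  (forall j, j < v -> digit l j) -> digit l v = false -> v = trailing_ones l.
Proof.
move=> lv nv; have [lt|gt|//] := ltngtP v (trailing_ones l).
- by rewrite digit_lt_trailing_ones in nv.
- by have := lv _ gt; rewrite digit_trailing_ones.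
Qed.

Lemma val2_inc l : val2 (inc l) = (val2 l).+1.
Proof. by elim: l => [|[] l IHl] //=; rewrite IHl; lia. Qed.

(** Lists with the same digits may differ by final zeros, which [val2] ignores. *)
Lemma eq_val2 l l' : (forall j, digit l j = digit l' j) -> val2 l = val2 l'.
Proof.
have z l0 : (forall j, false = digit l0 j) -> val2 l0 = 0.
  elim: l0 => //= b l0 IH E; have /= <- := E 0.
  by rewrite IH // => j; apply: (E j.+1).
elim: l l' => [|b l IHl] [|b' l'] // E.
- by rewrite (z (b' :: l')) // => j; rewrite -E nth_nil.
- by rewrite (z (b :: l)) // => j; rewrite E nth_nil.
- have /= -> := E 0; by rewrite (IHl l') // => j; apply: (E j.+1).
Qed.

(** * One cycle, from a report row to the next *)

Definition reports (y : config cell) (b T : Z) (s : nat) (D : nat -> bool) : Prop :=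
  [/\ rowph y T = Report,
      forall x, bd (y (x, T)) = (b <=? x)%Z,
      forall x, mk (y (x, T)) = (b - Z.of_nat s <=? x)%Z &
      forall j, dg (y (b + Z.of_nat j, T)%Z) = D j].

(** The signal needs [s] rows, the carry one and the return [v]. The digits are an arbitrary
    function here, as their finiteness is derived from this lemma. *)
Lemma reports_next y b T s D : valid y -> reports y b T s D ->
  0 < s /\ exists v : nat, [/\ v <= s.+1,
    forall j, j < v -> D j, D v = false,
    reports y b (T + Z.of_nat (s + 1 + v)) (s.+1 - v)
      (fun j => if j < v then false else if j == v then true else D j) &
    forall t, (T < t < T + Z.of_nat (s + 1 + v))%Z -> rowph y t <> Report].
Proof.
move=> yv [TR bdE mkE dgE].
have bdE' t x : bd (y (x, t)) = (b <=? x)%Z by rewrite -bdE; apply: bd_column.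
(* After [s.+1] rows the signal would be past the boundary, so the cut-off is not met. *)
have [u /andP[u0 us] [uC uW uE]] := wait_run y T yv TR s.+1 isT.
case: uC => [uC|[eu uC]]; last first.
  have [_ /(_ b)[]] := wait_row y _ yv uC.
  by case: (uE b) => _ -> _; rewrite bdE' mkE; lia.
(* On the carry row [sg] equals [bd]; comparing them at the jump of each gives both inequalities. *)
have {us} eu : u = s.
  have [_ cE] := carry_row y _ yv uC.
  case: (cE b) => + _ _ _; case: (cE (b + Z.of_nat u - Z.of_nat s)%Z) => + _ _ _.
  case: (uE b) => _ -> _; case: (uE (b + Z.of_nat u - Z.of_nat s)%Z) => _ -> _.
  rewrite !bdE' !mkE; lia.
subst u; split=> //.
have [phC cE] := carry_row y _ yv uC.
set H := (T + Z.of_nat s)%Z in uC cE uE phC *.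
have [v vs [vC vW vE]] := return_run y H yv uC s.+2.
(* The marker now stands at [b - s - 1 + v] and may not be right of [b]; so the cut-off [s.+2] is
   not met either. *)
have vle : v <= s.+1.
  have := bd_mk y yv b (H + 1 + Z.of_nat v)%Z.
  by case: (vE b) => -> _ _; case: (uE (b - Z.of_nat v + 1)%Z) => -> _ _; rewrite bdE' mkE; lia.
case: vC => [vC|[]]; last lia.
(* The report row has [cr] on the boundary; tracing it back through the return locates it on the
   carry row. *)
have crE x : cr (y (x, H)) = (b + Z.of_nat v <=? x)%Z.
  have [_ /(_ (x - Z.of_nat v)%Z)[+ _ _ _ _]] := report_row y _ yv vC.
  case: (vE (x - Z.of_nat v)%Z) => _ -> _; rewrite bdE'.
  by rewrite (_ : (_ + Z.of_nat v = x)%Z) => [->|]; lia.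
have dE j : dg (y (b + Z.of_nat j, H)%Z) = D j.
  by case: (uE (b + Z.of_nat j)%Z) => _ _ ->.
have dC j : if v < j then dg (y (b + Z.of_nat j, H + 1)%Z) == D j
            else if v == j then ~~ D j && dg (y (b + Z.of_nat j, H + 1)%Z)
            else D j && ~~ dg (y (b + Z.of_nat j, H + 1)%Z).
  case: (cE (b + Z.of_nat j)%Z) => _ _ _.
  rewrite !crE bdE' dE.
  have -> : (b <=? b + Z.of_nat j)%Z by lia.
  have -> : (b + Z.of_nat v <=? b + Z.of_nat j - 1)%Z = (v < j) by lia.
  case: ltnP => // le_jv.
  by have -> : (b + Z.of_nat v <=? b + Z.of_nat j)%Z = (v == j) by lia.
have eT : (T + Z.of_nat (s + 1 + v) = H + 1 + Z.of_nat v)%Z by rewrite /H; lia.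
exists v; rewrite eT; split=> // [j lt|||t].
- by move: (dC j); rewrite ltnNge (ltnW lt) /= gtn_eqF //; case: (D j).
- by move: (dC v); rewrite ltnn eqxx; case: (D v).
- split=> // [x|j].
  + case: (vE x) => -> _ _; case: (uE (x - Z.of_nat v + 1)%Z) => -> _ _; rewrite mkE; lia.
  + case: (vE (b + Z.of_nat j)%Z) => _ _ ->; move: (dC j).
    case: (ltngtP v j) => [_ /eqP->|_|<-]; first by [].
    * by case/andP=> _ /negbTE.
    * by case/andP.
- move=> [Tt tH].
  have [ltH|geH] := Z.lt_ge_cases t H.
    rewrite (_ : t = T + Z.of_nat (Z.to_nat (t - T)))%Z ?uW //; lia.
  have [->|neH] := Z.eq_dec t H; first by rewrite uC.
  rewrite (_ : t = H + 1 + Z.of_nat (Z.to_nat (t - H - 1)))%Z ?vW //; lia.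
Qed.

(** * Finiteness of the counter *)

Definition count_low (D : nat -> bool) (N : nat) := \sum_(i < N) D i.

(* Until a carry runs past position [N], both sides change alike; that carry meets [N]
   ones and moves the marker by as much without crossing the boundary. *)
Lemma reports_count y b T s D N : valid y -> reports y b T s D -> count_low D N <= s.
Proof.
(* [low D] is [2 ^ N - 1] minus the number written by the low [N] digits; it decreases until a carry
   runs through all of them. *)
move=> yv; pose low (D : nat -> bool) := \sum_(i < N) (~~ D i) * 2 ^ i.
have [n] := ubnP (low D); elim: n T s D => // n IHn T s D le_n yT.
have [s0 [v [vs Dv nDv yT']]] := reports_next y b T s D yv yT.
(* The next report row has positive width too, which sharpens [v <= s.+1] to [v <= s]. *)
move=> _; have [s0' _] := reports_next y b _ _ _ yv yT'.
have [le_Nv|lt_vN] := leqP N v.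
  apply: leq_trans (_ : N <= s); last lia.
  rewrite /count_low -[X in _ <= X]card_ord -sum1_card; apply: leq_sum => i _; exact: leq_b1.
set D' := fun j => _ in yT'.
have split3 (F : nat -> nat) : \sum_(i < N) F i =
    \sum_(i < v) F i + F v + \sum_(v.+1 <= i < N) F i.
  rewrite -(big_mkord xpredT) (@big_cat_nat _ _ _ v) //=; last exact: ltnW.
  by rewrite big_mkord big_ltn // addnA.
have tl (F G : nat -> nat) : (forall i, v < i -> F i = G i) ->
    \sum_(v.+1 <= i < N) F i = \sum_(v.+1 <= i < N) G i.
  by move=> FG; apply: eq_big_nat => i /andP[/FG].
have D'lt (i : 'I_v) : D' i = false by rewrite /D' ltn_ord.
have D'v : D' v = true by rewrite /D' ltnn eqxx.
have D'gt i : v < i -> D' i = D i.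
  by move=> lt; rewrite /D' ltnNge (ltnW lt) /= gtn_eqF.
have pow m : \sum_(i < m) 2 ^ i < 2 ^ m.
  by elim: m => [|m IHm]; rewrite ?big_ord0 // big_ord_recr /= expnS mul2n -addnn -addSn leq_add2r.
have cE : count_low D' N + v = count_low D N + 1.
  rewrite /count_low (split3 (fun i => D' i : nat)) (split3 (fun i => D i : nat)).
  rewrite (tl (fun i => D' i : nat) (fun i => D i : nat)); last by move=> i /D'gt->.
  have -> : \sum_(i < v) (D' i : nat) = 0 by apply: big1 => i _; rewrite D'lt.
  have -> : \sum_(i < v) (D i : nat) = v.
    by rewrite -[RHS]card_ord -sum1_card; apply: eq_bigr => i _; rewrite Dv.
  by rewrite nDv D'v; lia.
have lE : low D' < low D.
  rewrite /low (split3 (fun i => (~~ D' i) * 2 ^ i)) (split3 (fun i => (~~ D i) * 2 ^ i)).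
  rewrite (tl (fun i => (~~ D' i) * 2 ^ i) (fun i => (~~ D i) * 2 ^ i)); last by move=> i /D'gt->.
  have -> : \sum_(i < v) (~~ D i) * 2 ^ i = 0 by apply: big1 => i _; rewrite Dv.
  have -> : \sum_(i < v) (~~ D' i) * 2 ^ i = \sum_(i < v) 2 ^ i.
    by apply: eq_bigr => i _; rewrite D'lt mul1n.
  by rewrite nDv D'v mul0n mul1n addn0 add0n ltn_add2r.
have := IHn _ _ _ (leq_trans lE le_n) yT'; move: cE; lia.
Qed.

(** Induction on the bound: if some count attains it, no ones follow; otherwise the bound can be
    lowered by one. *)
Lemma count_finite (D : nat -> bool) (s : nat) :
  (forall N, count_low D N <= s) -> exists l : seq bool, forall j, D j = digit l j.
Proof.
move=> Ds; suff [N DN] : exists N, forall j, N <= j -> D j = false.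
  exists (mkseq D N) => j; have [ltj|lej] := ltnP j N; first by rewrite nth_mkseq.
  by rewrite nth_default ?size_mkseq ?DN.
elim: s Ds => [|s IHs] Ds.
  exists 0 => j _; have := Ds j.+1; rewrite /count_low big_ord_recr /=; case: (D j) => //; lia.
case: (classic (exists N, count_low D N = s.+1)) => [[N eN]|nN].
  exists N => j leNj; case E : (D j) => //.
  have := Ds j.+1; rewrite /count_low big_ord_recr /= E addn1 => lt.
  suff le : count_low D N <= \sum_(i < j) D i.
    by rewrite eN in le; have := leq_trans lt le; rewrite ltnn.
  rewrite /count_low -!(big_mkord xpredT (fun i => D i : nat)).
  by rewrite [X in _ <= X](@big_cat_nat _ _ _ N) ?leq_addr.
by apply: IHs => N; have := Ds N; rewrite leq_eqVlt => /orP[/eqP eN|//]; case: nN; exists N.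
Qed.

Lemma reports_digits y b T s D : valid y -> reports y b T s D ->
  exists l, reports y b T s (digit l).
Proof.
move=> yv yT.
have [l Dl] := count_finite D s (fun N => reports_count y b T s D N yv yT).
by exists l; case: yT => ? ? ? dgE; split=> // j; rewrite dgE Dl.
Qed.

(** * The orbit of a report row *)

Definition state : Type := Z * nat * seq bool.

Definition next_state (st : state) : state :=
  let: (T, s, l) := st in
  ((T + Z.of_nat (s + 1 + trailing_ones l))%Z, s.+1 - trailing_ones l, inc l).

Definition time (st : state) : Z := st.1.1.
Definition width (st : state) : nat := st.1.2.
Definition digits (st : state) : seq bool := st.2.

Definition reports_st y b st := reports y b (time st) (width st) (digit (digits st)).

Lemma reports_st_next y b st : valid y -> reports_st y b st ->
  [/\ trailing_ones (digits st) <= width st, reports_st y b (next_state st) &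
  forall t, (time st < t < time (next_state st))%Z -> rowph y t <> Report].
Proof.
case: st => [[T s] l] yv yT.
have [s0 [v [vs /trailing_onesP ev /ev {}ev yT' nR]]] := reports_next y b _ _ _ yv yT.
have [s0' _] := reports_next y b _ _ _ yv yT'.
subst v; split=> //; first by move: s0'; rewrite /width /digits /=; lia.
by case: yT' => ? ? ? dgE; split=> // j; rewrite dgE digit_inc.
Qed.

Lemma time_next st : (time st < time (next_state st))%Z.
Proof. by case: st => [[T s] l]; rewrite /time /=; lia. Qed.

Lemma time_iter st m n : m < n -> (time (iter m next_state st) < time (iter n next_state st))%Z.
Proof.
move=> /subnK<-; elim: (n - m.+1) => [|k IHk]; rewrite /=; first exact: time_next.
exact: Z.lt_trans (time_next _).
Qed.

Lemma time_iter_ge st n : (time st + Z.of_nat n <= time (iter n next_state st))%Z.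
Proof.
elim: n => [|n IHn]; first by rewrite /=; lia.
by have := time_next (iter n next_state st); rewrite /=; lia.
Qed.

Lemma reports_iter y b st n : valid y -> reports_st y b st -> reports_st y b (iter n next_state st).
Proof. by move=> yv yT; elim: n => //= n IHn; case: (reports_st_next y b _ yv IHn). Qed.

(** The times of the orbit grow without bound, and no report row lies strictly between two
    successive ones. *)
Lemma reports_orbit y b st t : valid y -> reports_st y b st -> (time st <= t)%Z ->
  rowph y t = Report -> exists n, time (iter n next_state st) = t.
Proof.
move=> yv yT le_t tR.
suff H n : (t < time (iter n next_state st))%Z -> exists n, time (iter n next_state st) = t.
  apply: (H (Z.to_nat (t - time st)).+1); have := time_iter_ge st (Z.to_nat (t - time st)).+1; lia.
elim: n => [|n IHn] /= lt; first lia.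
have [lt'|[->|gt']] := Z.lt_total t (time (iter n next_state st)); [exact: IHn|by exists n|].
have [_ _ /(_ t)] := reports_st_next y b _ yv (reports_iter y b st n yv yT).
by case; first lia.
Qed.

(* A complete wait transports the step of [mk] onto the step of [bd]. *)
Lemma two_reports y t1 t2 : valid y -> (t1 < t2)%Z ->
  rowph y t1 = Report -> rowph y t2 = Report ->
  exists2 u : nat, 0 < u & forall x, bd (y (x, t1)) = mk (y (x - Z.of_nat u, t1)%Z).
Proof.
move=> yv lt t1R t2R.
have [|u /andP[u0 un] [uC uW uE]] := wait_run y t1 yv t1R (Z.to_nat (t2 - t1)); first lia.
case: uC => [uC|[-> ]]; last first.
  by rewrite (_ : (t1 + _ = t2)%Z) ?t2R //; lia.
exists u => // x; have [_ /(_ x)[+ _ _ _]] := carry_row y _ yv uC.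
by case: (uE x) => _ -> _; rewrite (bd_column y yv x _ t1) => <-.
Qed.

(** As [mk] holds at [x1], [bd] holds [u] cells further right, while it fails at [x1]: it does
    jump. *)
Lemma two_reports_boundary y x1 t1 t2 : valid y -> (t1 < t2)%Z ->
  rowph y t1 = Report -> rowph y t2 = Report ->
  mk (y (x1, t1)) -> bd (y (x1, t1)) = false ->
  exists b, forall x, bd (y (x, t1)) = (b <=? x)%Z.
Proof.
move=> yv lt t1R t2R mk1 bd1; have [u _ bdmk] := two_reports y t1 t2 yv lt t1R t2R.
apply: (Zmono_jump _ x1 (x1 + Z.of_nat u)%Z (bd_mono y yv t1) bd1).
by rewrite bdmk (_ : (_ - _ = x1)%Z) //; lia.
Qed.

Lemma two_reports_state y b t1 t2 : valid y -> (t1 < t2)%Z ->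
  rowph y t1 = Report -> rowph y t2 = Report ->
  (forall x, bd (y (x, t1)) = (b <=? x)%Z) ->
  exists2 st, reports_st y b st & time st = t1.
Proof.
move=> yv lt t1R t2R bdE; have [u _ bdmk] := two_reports y t1 t2 yv lt t1R t2R.
have [|l yl] := reports_digits y b t1 u (fun j => dg (y (b + Z.of_nat j, t1)%Z)) yv.
  split=> // x.
  by have := bdmk (x + Z.of_nat u)%Z; rewrite bdE (_ : (_ - _ = x)%Z) => [<-|]; lia.
by exists (t1, u, l).
Qed.

(** * Displayed pictures and their countability *)

Definition display (y : config cell) : config bool :=
  fun p => [&& ph (y p) == Report, mk (y p) & ~~ bd (y p)].

Lemma displayE y x t : valid y ->
  display y (x, t) = [&& rowph y t == Report, mk (y (x, t)) & ~~ bd (y (x, t))].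
Proof. by move=> yv; rewrite /display ph_row. Qed.

(** The search for [n] is bounded because every cycle takes at least one row; this keeps the value
    boolean. *)
Definition segments (b : Z) (st : state) : config bool := fun p =>
  has (fun n => let st' := iter n next_state st in
        [&& (time st' =? p.2)%Z, (b - Z.of_nat (width st') <=? p.1)%Z & (p.1 <? b)%Z])
    (iota 0 (Z.to_nat (p.2 - time st)).+1).

Lemma segmentsP b st x t : segments b st (x, t) <->
  exists2 n, time (iter n next_state st) = t &
             (b - Z.of_nat (width (iter n next_state st)) <= x < b)%Z.
Proof.
split=> [/hasP[n _ /= /and3P[? ? ?]]|[n eT xE]]; first by exists n; lia.
apply/hasP; exists n; last by rewrite /= eT; lia.
by rewrite mem_iota /=; have := time_iter_ge st n; lia.
Qed.

(** A lone segment may be infinite on either side, since a single report row forces neither marker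
    nor boundary to exist. *)
Definition bar (T : Z) (e1 e2 : bool + Z) : config bool :=
  fun p => [&& (p.2 =? T)%Z, step e1 p.1 & ~~ step e2 p.1].

Lemma display_segments y b st : valid y -> reports_st y b st ->
  (forall t, (t < time st)%Z -> rowph y t <> Report) -> display y = segments b st.
Proof.
move=> yv yT first; apply: functional_extensionality => -[x t].
apply/idP/idP => [|/segmentsP[n <- xE]].
- rewrite displayE // => /and3P[/eqP tR mkx bdx]; apply/segmentsP.
  have le_t : (time st <= t)%Z by case: (Z.le_gt_cases (time st) t) => // /first.
  have [n eT] := reports_orbit y b st t yv yT le_t tR; exists n => //.
  case: (reports_iter y b st n yv yT) => _ bdE mkE _; move: mkx bdx.
  by rewrite -eT bdE mkE; lia.
- case: (reports_iter y b st n yv yT) => nR bdE mkE _.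
  by rewrite displayE // nR mkE bdE /=; lia.
Qed.

(** An earlier report row has a smaller counter value, so the descent ends. *)
Lemma reports_first y b st : valid y -> reports_st y b st ->
  exists2 st0, reports_st y b st0 & forall t, (t < time st0)%Z -> rowph y t <> Report.
Proof.
move=> yv; have [n] := ubnP (val2 (digits st)); elim: n st => // n IHn st le_n yT.
case: (classic (exists2 t, (t < time st)%Z & rowph y t = Report)) => [[t lt tR]|nt].
- case: (yT) => stR bdE _ stD.
  have bdE' x : bd (y (x, t)) = (b <=? x)%Z by rewrite -bdE; apply: bd_column.
  have [st' yT' eT'] := two_reports_state y b t (time st) yv lt tR stR bdE'.
  apply: (IHn st') => //.
  have [|[|m] em] := reports_orbit y b st' (time st) yv yT' _ stR; first lia.
    by move: em => /=; lia.
  have [_ _ _ D] := reports_iter y b st' m.+1 yv yT'.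
  suff : val2 (digits st') < val2 (digits st) by lia.
  rewrite -(eq_val2 (digits (iter m.+1 next_state st')) (digits st)) => [|j]; last first.
    by rewrite -D -stD em.
  elim: (m) => [|k IHk] /=; first by case: (st') => [[? ?] ?] /=; rewrite val2_inc.
  apply: leq_trans IHk _; rewrite /=; case: (next_state _) => [[? ?] ?] /=.
  by rewrite val2_inc.
- by exists st => // t lt tR; apply: nt; exists t.
Qed.

Lemma display_class y : valid y ->
  (exists T e1 e2, display y = bar T e1 e2) \/ (exists b st, display y = segments b st).
Proof.
move=> yv.
case: (classic (exists p1 p2, [/\ (p1.2 < p2.2)%Z, display y p1 & display y p2])).
  move=> [[x1 t1] [[x2 t2] /= []]] lt; rewrite !displayE //.
  move=> /and3P[/eqP t1R mk1 /negbTE bd1] /and3P[/eqP t2R _ _].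
  have [b bdE] := two_reports_boundary y x1 t1 t2 yv lt t1R t2R mk1 bd1.
  have [st yT _] := two_reports_state y b t1 t2 yv lt t1R t2R bdE.
  have [st0 yT0 st0P] := reports_first y b st yv yT.
  by right; exists b, st0; apply: display_segments.
move=> n2; left; case: (classic (exists p, display y p)) => [[[x T] xT]|n1]; last first.
  exists 0%Z, (inl false), (inl false); apply: functional_extensionality => p.
  by rewrite /bar /= andbF; apply/negP => yp; apply: n1; exists p.
have [e1 e1E] := Zmono_is_step _ (mk_mono y yv T).
have [e2 e2E] := Zmono_is_step _ (bd_mono y yv T).
exists T, e1, e2; apply: functional_extensionality => -[x' t]; rewrite /bar /=.
case: Z.eqb_spec => [->|ne] /=.
  by rewrite -e1E -e2E displayE //; move: xT; rewrite displayE // => /and3P[-> _ _].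
apply/negP => yt; apply: n2.
have [lt|gt] := Z.lt_ge_cases t T; first by exists (x', t), (x, T).
by exists (x, T), (x', t); split=> //=; lia.
Qed.

Lemma countable_set_range (A : Type) (P : countType) (dec : P -> config A)
    (X : config A -> Prop) :
  (forall x, X x -> exists p, dec p = x) -> countable_set X.
Proof.
move=> XP; pose g x := if excluded_middle_informative (exists p, dec p = x) is left h
  then pickle (proj1_sig (constructive_indefinite_description _ h)) else 0.
exists g => x y /XP px /XP py; rewrite /g.
case: excluded_middle_informative => // hx; case: excluded_middle_informative => // hy.
case: constructive_indefinite_description => p /= ep.
case: constructive_indefinite_description => q /= eq /(congr1 (@unpickle P)).
by rewrite !pickleK => -[epq]; rewrite -ep -eq epq.
Qed.

Lemma display_countable :
  countable_set (fun x : config bool => exists y, valid y /\ display y = x).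
Proof.
pose P : countType := ((Z * (bool + Z) * (bool + Z)) + (Z * state))%type.
apply: (@countable_set_range _ P (fun p => match p with
  | inl (T, e1, e2) => bar T e1 e2 | inr (b, st) => segments b st end)).
move=> _ [y [yv <-]]; case: (display_class y yv) => [[T [e1 [e2 ->]]]|[b [st ->]]].
- by exists (inl (T, e1, e2)).
- by exists (inr (b, st)).
Qed.

(** * Explicit valid configurations *)

Definition ones (l : seq bool) : nat := count id l.

Lemma ones_inc l : ones (inc l) + trailing_ones l = (ones l).+1.
Proof. by elim: l => [|[] l IHl] //=; rewrite /ones /= in IHl *; lia. Qed.

(* A row with boundary at 0: marker at [- rs], signal at [rw], end of the carry at [rc]. *)
Record row := Row { rph : phase; rs : Z; rw : Z; rc : Z; rl : seq bool }.

Definition paint (r : row) (x : Z) : cell :=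
  Cell (rph r) (0 <=? x)%Z (- rs r <=? x)%Z (rw r <=? x)%Z (rc r <=? x)%Z
    ((0 <=? x)%Z && digit (rl r) (Z.to_nat x)).

(** The signal is put on the marker, as the rule demands on report rows. *)
Definition return_to (s c : Z) (l : seq bool) : row :=
  Row (if (c =? 0)%Z then Report else Return) s (- s) c l.

Definition next_row (r : row) : row :=
  let: Row p s w c l := r in
  match p with
  | Report | Wait =>
      if (w + 1 =? 0)%Z then Row Carry s (w + 1) (Z.of_nat (trailing_ones l)) l
      else Row Wait s (w + 1) c l
  | Carry => return_to (s + 1) c (inc l)
  | Return => return_to (s - 1) (c - 1) l
  end.

(** In a return row [s - c] is the distance at which the marker will stop. Having more room than
    ones keeps the marker from crossing the boundary. *)
Definition row_ok (r : row) : Prop :=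
  let: Row p s w c l := r in
  match p with
  | Report => [/\ c = 0, w = - s & Z.of_nat (ones l) < s]%Z
  | Wait => [/\ w < 0 & Z.of_nat (ones l) < s]%Z
  | Carry => [/\ w = 0, c = Z.of_nat (trailing_ones l) & Z.of_nat (ones l) < s]%Z
  | Return => [/\ 0 < c & Z.of_nat (ones l) < s - c]%Z
  end.

Lemma next_row_ok r : row_ok r -> row_ok (next_row r).
Proof.
case: r => [[] s w c l] /=.
- by case=> -> -> lt; case: Z.eqb_spec => eq; split=> //; lia.
- by case=> ? lt; case: Z.eqb_spec => eq; split=> //; lia.
- move=> [_ -> lt]; have := ones_inc l; rewrite /return_to.
  by case: Z.eqb_spec => eq oE; split=> //; lia.
- by case=> ? lt; rewrite /return_to; case: Z.eqb_spec => eq; split=> //; lia.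
Qed.

Lemma paint_rule r x : row_ok r ->
  rule (paint r (x - 1)) (paint r x) (paint r (x + 1)) (paint (next_row r) x).
Proof.
case: r => [[] s w c l]; rewrite /row_ok /rule /paint /=.
- case=> -> -> lt; rewrite eqxx /=.
  by case: Z.eqb_spec => eq /=; rewrite ?inE ?eqxx /=; lia.
- case=> ? lt; rewrite eqxx /=.
  by case: Z.eqb_spec => eq /=; rewrite ?inE ?eqxx /=; lia.
- case=> -> -> lt; rewrite !eqxx /return_to /=.
  have -> : (if (Z.of_nat (trailing_ones l) =? 0)%Z then Report else Return)
      \in [:: Return; Report].
    by case: ifP.
  rewrite digit_inc.
  (* Left of the boundary [cr] and [bd] are false, so the digit clause asks nothing. *)
  have [x0|x0] := Z.leb_spec 0 x; last first.
    have -> : (Z.of_nat (trailing_ones l) <=? x - 1)%Z = false by lia.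
    have -> : (Z.of_nat (trailing_ones l) <=? x)%Z = false by lia.
    by rewrite /=; lia.
  have [j ej] : exists j, x = Z.of_nat j by exists (Z.to_nat x); lia.
  subst x; rewrite Nat2Z.id /=.
  have -> : (Z.of_nat (trailing_ones l) <=? Z.of_nat j - 1)%Z = (trailing_ones l < j) by lia.
  have -> : (Z.of_nat (trailing_ones l) <=? Z.of_nat j)%Z = (trailing_ones l <= j) by lia.
  have := digit_lt_trailing_ones l j; have := digit_trailing_ones l.
  case: (ltngtP j (trailing_ones l)) => [lt'|gt'|->] H1 H2.
  + rewrite (H2 isT) /=; lia.
  + rewrite eqxx; lia.
  + rewrite H1 /=; lia.
- case=> ? lt; rewrite !eqxx /return_to /=.
  have -> : ((if (c - 1 =? 0)%Z then Report else Return) \in [:: Return; Report]).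
    by case: ifP.
  lia.
Qed.

(** Below row 0 there is an endless return phase, with [cr] and the marker coming in from infinity
    on either side; hence row 0 is the first report row. *)
Definition rows (i : nat) (t : Z) : row :=
  if (t <? 0)%Z then return_to (Z.of_nat i - t) (- t) [::]
  else iter (Z.to_nat t) next_row (return_to (Z.of_nat i) 0 [::]).

Lemma rows_ok i t : 0 < i -> row_ok (rows i t).
Proof.
move=> i0; rewrite /rows; case: Z.ltb_spec => t0.
  rewrite /return_to; case: Z.eqb_spec => [|_]; first lia.
  by split; rewrite /=; lia.
elim: (Z.to_nat t) => [|n IHn] /=; last exact: next_row_ok.
by split=> //=; lia.
Qed.

Lemma rows_next i t : rows i (t + 1) = next_row (rows i t).
Proof.
rewrite /rows; case: (Z.ltb_spec t 0) => t0; last first.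
  have -> : (t + 1 <? 0)%Z = false by lia.
  by rewrite (_ : Z.to_nat (t + 1) = (Z.to_nat t).+1) //; lia.
rewrite [X in _ = next_row X]/return_to; have -> : (- t =? 0)%Z = false by lia.
case: Z.ltb_spec => t1 /=; first by congr return_to; lia.
have -> : Z.to_nat (t + 1) = 0 by lia.
by congr return_to; lia.
Qed.

Definition odometer (i : nat) : config cell := fun p => paint (rows i p.2) p.1.

Lemma odometer_valid i : 0 < i -> valid (odometer i).
Proof.
by move=> i0 x t; rewrite /odometer /= rows_next; apply: paint_rule; apply: rows_ok.
Qed.

Definition start (i : nat) : state := (0%Z, i, [::]).

Lemma odometer_display i : 0 < i -> display (odometer i) = segments 0 (start i).
Proof.
move=> i0; apply: display_segments; first exact: odometer_valid.
  by split=> // j; rewrite nth_nil /odometer /= nth_nil andbF.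
move=> t; rewrite /time /rowph /odometer /rows /= => lt.
have -> : (t <? 0)%Z = true by lia.
by rewrite /=; case: Z.eqb_spec => //; lia.
Qed.

(** * The descending chain *)

Lemma digits_iter st n : digits (iter n next_state st) = iter n inc (digits st).
Proof. by elim: n => //= n <-; case: (iter _ _ _) => [[? ?] ?]. Qed.

Lemma width_iter i n :
  width (iter n next_state (start i)) = i + ones (digits (iter n next_state (start i))).
Proof.
elim: n => /= [|n]; first by rewrite addn0.
case: (iter _ _ _) => [[T s] l]; rewrite /width /digits /= => ->.
have := ones_inc l; lia.
Qed.

(** To fill one more zero: fill the low [N], let one carry pass into the next digit, and fill the
    low [N] again. *)
Lemma inc_fill N l : exists n, iter n inc (nseq N false ++ l) = nseq N true ++ l.
Proof.
elim: N l => [|N IHN] l; first by exists 0.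
have nseqS b l' : nseq N.+1 b ++ l' = nseq N b ++ b :: l'.
  by rewrite -cat_rcons; congr (_ ++ _); elim: N {IHN} => //= N <-.
have [n1 E1] := IHN (false :: l); have [n2 E2] := IHN (true :: l).
have inc1 : inc (nseq N true ++ false :: l) = nseq N false ++ true :: l.
  by elim: N {IHN nseqS E1 E2} => //= N ->.
by exists (n2 + n1.+1); rewrite !nseqS iterD iterS E1 inc1.
Qed.

Lemma inc_ones N : inc (nseq N true) = nseq N false ++ [:: true].
Proof. by elim: N => //= N ->. Qed.

Lemma inc_all_ones N : exists n, iter n inc [::] = nseq N true.
Proof.
elim: N => [|N [n E]]; first by exists 0.
have [n' E'] := inc_fill N [:: true].
exists (n' + n.+1); rewrite iterD /= E inc_ones E'.
by elim: N {E E'} => //= N ->.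
Qed.

Lemma trailing_ones_nseq N : trailing_ones (nseq N true) = N.
Proof. by elim: N => //= N ->. Qed.

(** Within the low [N] digits, [n] increments from zero change only those below [n]. So each of
    these carries stops where both counters agree, and has the same length in both. *)
Lemma iter_agree N st1 st2 n :
  width st1 = width st2 ->
  (forall j, j < N -> digit (digits st1) j = false) ->
  (forall j, j < N -> digit (digits st2) j = false) -> n <= N ->
  let st1' := iter n next_state st1 in let st2' := iter n next_state st2 in
  [/\ (time st1' - time st1 = time st2' - time st2)%Z, width st1' = width st2',
      forall j, j < N -> digit (digits st1') j = digit (digits st2') j &
      forall j, n <= j < N -> digit (digits st1') j = false].
Proof.
move=> ew z1 z2; elim: n => [_|n IHn lt] /=.
  by split=> [|//|j ltj|j ltj]; [lia|rewrite z1 ?z2|exact: z1].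
case: (IHn (ltnW lt)) => {IHn}.
case: (iter n _ st1) => [[T1 s1] l1]; case: (iter n _ st2) => [[T2 s2] l2].
rewrite /time /width /digits /= => eT es el z; subst s2.
have tn : trailing_ones l1 <= n.
  by rewrite leqNgt; apply/negP => /digit_lt_trailing_ones; rewrite z // leqnn.
have et : trailing_ones l1 = trailing_ones l2.
  apply: trailing_onesP => [j ltj|]; rewrite -el ?digit_trailing_ones
    ?digit_lt_trailing_ones //; lia.
split=> [||j ltj|j /andP[ltj jN]]; [lia|by rewrite et| |].
- by rewrite !digit_inc -et el.
- by rewrite digit_inc ltnNge (leq_trans tn (ltnW ltj)) /= gtn_eqF ?z //; lia.
Qed.

Lemma segments_window i N : exists T, forall x t, (Z.abs t < Z.of_nat N)%Z ->
  segments 0 (start i) (x, t + T)%Z = segments 0 (start i.+1) (x, t).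
Proof.
(* [st] has counter value [2 ^ N - 1], and the report row after it becomes the centre of the
   window. *)
have [n0 E0] := inc_all_ones N.
pose st := iter n0 next_state (start i).
have dst : digits st = nseq N true by rewrite /st digits_iter E0.
have wst : width st = i + N by rewrite /st width_iter -/st dst /ones count_nseq mul1n.
have d1 : digits (next_state st) = nseq N false ++ [:: true].
  by rewrite -inc_ones -dst; case: (st) => [[? ?] ?].
have w1 : width (next_state st) = i.+1.
  by move: wst dst; case: (st) => [[? s] l]; rewrite /width /digits /= => -> ->;
    rewrite trailing_ones_nseq; lia.
(* The return through [N] trailing ones is long enough to keep earlier report rows out of the
   window. *)
have gap : (time st + Z.of_nat N < time (next_state st))%Z.
  by move: dst; case: (st) => [[? s] l]; rewrite /time /digits /= => ->;
    rewrite trailing_ones_nseq; lia.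
have z1 j : j < N -> digit (digits (next_state st)) j = false.
  by move=> ltj; rewrite d1 nth_cat size_nseq ltj nth_nseq ltj.
have z2 j : j < N -> digit (digits (start i.+1)) j = false by rewrite /= nth_nil.
have agree n := iter_agree N (next_state st) (start i.+1) n w1 z1 z2.
have after m : iter (m + n0.+1) next_state (start i) = iter m next_state (next_state st).
  by rewrite iterD.
have t0 : time (start i.+1) = 0%Z by [].
exists (time (next_state st)) => x t tN; apply/idP/idP => /segmentsP[n eT xE].
- have lt_n : n0 < n.
    rewrite ltnNge; apply/negP; rewrite leq_eqVlt => /orP[/eqP en|/(time_iter (start i)) lt].
      by move: eT; rewrite en -/st; lia.
    by rewrite -/st in lt; lia.
  move: eT xE; rewrite -(subnK lt_n) after => eT xE.
  have ge := time_iter_ge (next_state st) (n - n0.+1).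
  have [|eTT ew _ _] := agree (n - n0.+1); first lia.
  by apply/segmentsP; exists (n - n0.+1); [lia|rewrite -ew].
- have ge := time_iter_ge (start i.+1) n.
  have [|eTT ew _ _] := agree n; first lia.
  by apply/segmentsP; exists (n + n0.+1); rewrite after; [lia|rewrite ew].
Qed.

Lemma pattern_bounded (A : Type) (P : pattern A) (v : Z * Z) :
  exists N, forall pa, List.In pa P -> (Z.abs (vadd pa.1 v).2 < Z.of_nat N)%Z.
Proof.
elim: P => [|a P [N PN]]; first by exists 0.
exists (maxn N (Z.to_nat (Z.abs (vadd a.1 v).2)).+1) => pa [<-|/PN]; lia.
Qed.

Lemma segments_gt i : 0 < i -> sub_gt (segments 0 (start i)) (segments 0 (start i.+1)).
Proof.
move=> i0; split=> [P [v occ]|ge].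
  have [N PN] := pattern_bounded _ P v; have [T winT] := segments_window i N.
  exists (v.1, v.2 + T)%Z => pa paP; rewrite -(occ pa paP); move: (PN _ paP).
  case: pa {paP} => [[x t] a]; rewrite /vadd; cbn [fst snd] => tN.
  by rewrite Z.add_assoc winT.
(* A segment of length at most [i] with its right end visible; from [start i.+1] on, all widths are
   at least [i.+1]. *)
pose P : pattern bool :=
  [:: ((- Z.of_nat i - 1, 0)%Z, false); ((-1, 0)%Z, true); ((0, 0)%Z, false)].
have /ge[[x t] occ] : occurs P (segments 0 (start i)).
  exists (0, 0)%Z => pa [<-|[<-|[<-|[]]]]; rewrite /vadd; cbn [fst snd].
  - apply/negP => /segmentsP[[_|n eT _]]; first by rewrite /width /=; lia.
    by have := time_iter_ge (start i) n.+1; rewrite eT (_ : time (start i) = 0%Z) //; lia.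
  - by apply/segmentsP; exists 0; rewrite // /width /=; lia.
  - by apply/negP => /segmentsP[n _]; lia.
have := occ _ (or_introl erefl); have := occ _ (or_intror (or_introl erefl)).
have := occ _ (or_intror (or_intror (or_introl erefl))).
rewrite /vadd; cbn [fst snd] => f0 /segmentsP[n eT xE] f1.
have wn := width_iter i.+1 n.
(* If [x < 0], the segment also covers cell [x]; otherwise [x = 0], and it covers cell [- i - 1]. *)
have [x0|x0] := Z.lt_ge_cases x 0.
- by move/negP: f0; apply; apply/segmentsP; exists n => //; lia.
- by move/negP: f1; apply; apply/segmentsP; exists n => //; lia.
Qed.

(** * Soficity and conclusion *)

Lemma display_sofic : sofic (fun x : config bool => exists y, valid y /\ display y = x).
Proof.
have [F FE] := SFT_of_rule cell rule.
exists cell, F, display; split; [split|].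
(* [display] reads a single cell, so the window [W] itself suffices for continuity. *)
- by move=> y _ W; exists W => z _ yz p pW; rewrite /display (yz p pW).
- by [].
- by move=> x; split=> -[y [yv yx]]; exists y; split=> //; apply/FE.
Qed.

Theorem theorem17 :
  exists (A : finType) (X : config A -> Prop),
    sofic X /\ countable_set X /\
    exists x : nat -> config A,
      (forall i, 1 <= i -> X (x i)) /\
      (forall i, 1 <= i -> sub_gt (x i) (x i.+1)).
Proof.
exists bool, (fun x => exists y, valid y /\ display y = x).
split; first exact: display_sofic.
split; first exact: display_countable.
exists (fun i => segments 0 (start i)); split=> i i0; last exact: segments_gt.
by exists (odometer i); split; [apply: odometer_valid|apply: odometer_display].
Qed.
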